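(* Let $\alpha$ be a hybrid program of differential dynamic logic ($d\mathcal{L}$), and let $I$, $C$, $S$ be $d\mathcal{L}$ formulas. If the three formulas $$I \wedge \neg C \rightarrow [(\alpha;\, ?\neg C)^*]\, S, \qquad C \rightarrow [\alpha]\, C, \qquad C \rightarrow S$$ are valid, then $I \rightarrow [\alpha^*]\, S$ is valid. Equivalently, the inference rule $$\frac{I \wedge \neg C \rightarrow [(\alpha ;? \neg C )^*] S \qquad C \rightarrow [\alpha] C \qquad C \rightarrow S}{I \rightarrow [\alpha^*] S}$$ is sound for $d\mathcal{L}$.
   Context: Hybrid programs are generated by $\alpha,\beta ::= x:=\theta \mid x:=* \mid \{x_1'=\theta_1,\dots,x_n'=\theta_n \,\&\, H\} \mid ?H \mid \alpha\cup\beta \mid \alpha;\beta \mid \alpha^*$, with terms $\theta_i$ and formulas $H$. Fix an interpretation $\mathcal{I}$ of the rigid symbols and an assignment $\eta$ of the logical variables. A state is a map from the state variables to $\mathbb{R}$. Each hybrid program $\alpha$ denotes a transition relation $\rho_{\mathcal{I},\eta}(\alpha)$ on states: $x:=\theta$ updates $x$ to the value of $\theta$; $x:=*$ assigns an arbitrary real value to $x$; the ODE program relates $\nu$ to $\omega$ iff some solution flow of duration $r\ge 0$ goes from $\nu$ to $\omega$ and satisfies $H$ throughout; $\rho(?H)=\{(\nu,\nu): \nu\models H\}$; $\rho(\alpha\cup\beta)=\rho(\alpha)\cup\rho(\beta)$; $\rho(\alpha;\beta)$ is the relational composition (first $\alpha$, then $\beta$); $(\nu,\omega)\in\rho(\alpha^*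 )$ iff there are states $\nu=\nu_0,\dots,\nu_n=\omega$, $n\ge0$, with $(\nu_i,\nu_{i+1})\in\rho(\alpha)$ for all $i$. The formula $[\alpha]\phi$ holds in state $\nu$ iff $\phi$ holds in every $\omega$ with $(\nu,\omega)\in\rho(\alpha)$. Formulas are built from comparisons of terms, propositional connectives, quantifiers and the modalities $[\alpha]$, $\langle\alpha\rangle$. A formula is valid if it holds in all states under all interpretations and assignments; an inference rule is sound if validity of all premises implies validity of the conclusion. *)

(* Defs.v *)
From HB Require Import structures.
From mathcomp Require Import all_boot all_order all_algebra.
From mathcomp Require Import all_classical all_reals all_analysis.

Set Implicit Arguments.
Unset Strict Implicit.
Unset Printing Implicit Defensive.

Import Order.TTheory GRing.Theory Num.Theory.
Import numFieldNormedType.Exports.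

Local Open Scope classical_set_scope.
Local Open Scope ring_scope.

(** Flexible symbols are the state variables [svar]; the rigid symbols [fsym]
    are function symbols of arbitrary arity (constants being those of arity 0). *)
Record signature := Signature {
  svar : eqType;
  lvar : eqType;
  fsym : Type;
  arity : fsym -> nat
}.

Inductive dlterm (G : signature) : Type :=
| TSVar of svar G
| TLVar of lvar G
| TConst of rat
| TOpp of dlterm G
| TAdd of dlterm G & dlterm G
| TSub of dlterm G & dlterm G
| TMul of dlterm G & dlterm G
| TDiv of dlterm G & dlterm G
| TApp (f : fsym G) of ('I_(arity f) -> dlterm G).

Inductive cmpop := CEq | CNe | CLe | CLt | CGe | CGt.

(** Tests and evolution domains may be arbitrary formulas, modalities included,
    so programs and formulas are mutually recursive.  [POde n x th H] is
    [{x_1' = th_1, ..., x_n' = th_n & H}], the equations being indexed from 0.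
    Quantifiers bind logical variables. *)
Inductive dlprog (G : signature) : Type :=
| PAssign of svar G & dlterm G
| PAny of svar G
| POde (n : nat) of ('I_n -> svar G) & ('I_n -> dlterm G) & dlform G
| PTest of dlform G
| PChoice of dlprog G & dlprog G
| PSeq of dlprog G & dlprog G
| PStar of dlprog G
with dlform (G : signature) : Type :=
| FCmp of cmpop & dlterm G & dlterm G
| FNot of dlform G
| FAnd of dlform G & dlform G
| FOr of dlform G & dlform G
| FImp of dlform G & dlform G
| FIff of dlform G & dlform G
| FForall of lvar G & dlform G
| FExists of lvar G & dlform G
| FBox of dlprog G & dlform G
| FDiamond of dlprog G & dlform G.

Section Semantics.
Variables (R : realType) (G : signature).

Definition state := svar G -> R.
Definition assignment := lvar G -> R.
Definition interpretation := forall f : fsym G, ('I_(arity f) -> R) -> R.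

(** Division is total, with value 0 when the divisor is 0. *)
Fixpoint eval (J : interpretation) (eta : assignment) (nu : state)
    (t : dlterm G) : R :=
  match t with
  | TSVar x => nu x
  | TLVar z => eta z
  | TConst q => ratr q
  | TOpp a => - eval J eta nu a
  | TAdd a b => eval J eta nu a + eval J eta nu b
  | TSub a b => eval J eta nu a - eval J eta nu b
  | TMul a b => eval J eta nu a * eval J eta nu b
  | TDiv a b => eval J eta nu a / eval J eta nu b
  | TApp f args => J f (fun i => eval J eta nu (args i))
  end.

Definition cmp_sem (c : cmpop) (a b : R) : Prop :=
  match c with
  | CEq => a = b
  | CNe => a <> b
  | CLe => a <= b
  | CLt => a < b
  | CGe => a >= b
  | CGt => a > b
  end.

(** [flow], of which only the values on [[0, r]] matter, solves the system
    [x_i' = th_i] for duration [r]: each [x_i] is continuous on [[0, r]] and has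
    derivative [th_i] on the open interval, so that a flow of duration 0 is
    just a point; the variables without an equation do not change. *)
Definition solves (J : interpretation) (eta : assignment) (n : nat)
    (x : 'I_n -> svar G) (th : 'I_n -> dlterm G) (r : R)
    (flow : R -> state) : Prop :=
  [/\ forall i : 'I_n,
        {within `[0, r], continuous (fun t : R => flow t (x i))},
      forall (i : 'I_n) (t : R), 0 < t < r ->
        is_derive t 1 (fun s : R => flow s (x i)) (eval J eta (flow t) (th i)) &
      forall y : svar G, (forall i, y <> x i) ->
        forall t : R, 0 <= t <= r -> flow t y = flow 0 y].

Fixpoint rho (J : interpretation) (a : dlprog G) (eta : assignment)
    (nu om : state) {struct a} : Prop :=
  match a with
  | PAssign x th => om = [eta nu with x |-> eval J eta nu th]
  | PAny x => exists v : R, om = [eta nu with x |-> v]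
  | POde n x th H => exists (r : R) (flow : R -> state),
      [/\ 0 <= r, flow 0 = nu, flow r = om, solves J eta x th r flow &
          forall t : R, 0 <= t <= r -> sat J H eta (flow t)]
  | PTest H => om = nu /\ sat J H eta nu
  | PChoice b c => rho J b eta nu om \/ rho J c eta nu om
  | PSeq b c => exists mu : state, rho J b eta nu mu /\ rho J c eta mu om
  | PStar b => exists (n : nat) (s : nat -> state),
      [/\ s 0%N = nu, s n = om &
          forall i, (i < n)%N -> rho J b eta (s i) (s i.+1)]
  end
with sat (J : interpretation) (p : dlform G) (eta : assignment)
    (nu : state) {struct p} : Prop :=
  match p with
  | FCmp c a b => cmp_sem c (eval J eta nu a) (eval J eta nu b)
  | FNot q => ~ sat J q eta nu
  | FAnd q q' => sat J q eta nu /\ sat J q' eta nu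
  | FOr q q' => sat J q eta nu \/ sat J q' eta nu
  | FImp q q' => sat J q eta nu -> sat J q' eta nu
  | FIff q q' => sat J q eta nu <-> sat J q' eta nu
  | FForall z q => forall v : R, sat J q [eta eta with z |-> v] nu
  | FExists z q => exists v : R, sat J q [eta eta with z |-> v] nu
  | FBox a q => forall om : state, rho J a eta nu om -> sat J q eta om
  | FDiamond a q => exists om : state, rho J a eta nu om /\ sat J q eta om
  end.

Definition valid (p : dlform G) : Prop :=
  forall (J : interpretation) (eta : assignment) (nu : state), sat J p eta nu.

End Semantics.

(* Main.v *)
(** Follow a run of [alpha^*] from a state of [I].  If [C] holds somewhere along
    the run, it persists by the second premise, so [C] and hence [S] hold at the
    end.  Otherwise every state of the run satisfies [~ C]; the run is then
    also one of [(alpha; ?~C)^*], and the first premise applies. *)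
Require Import Defs.
From mathcomp Require Import all_boot all_order all_algebra.
From mathcomp Require Import all_classical all_reals all_analysis.

(** Induction on the distance [k] from [i]. A run changes neither [J] nor [eta], so the invariance
    of [C] is assumed for these two alone, but in every state. *)
Lemma sat_persists (R : realType) (G : signature) (J : interpretation R G)
    (eta : assignment R G) (alpha : dlprog G) (C : dlform G)
    (n : nat) (s : nat -> state R G) :
  (forall nu, sat J (FImp C (FBox alpha C)) eta nu) ->
  (forall i, (i < n)%N -> rho J alpha eta (s i) (s i.+1)) ->
  forall i, (i <= n)%N -> sat J C eta (s i) -> sat J C eta (s n).
Proof.
move=> invC run i le_in Ci.
suff H k : (i + k <= n)%N -> sat J C eta (s (i + k)%N).
  by have := H (n - i)%N; rewrite subnKC //; apply.
elim: k => [|k IHk]; first by rewrite addn0.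
rewrite addnS => lt_kn.
exact: invC _ (IHk (ltnW lt_kn)) _ (run _ lt_kn).
Qed.

Theorem mainTheorem1 (R : realType) (G : signature)
    (alpha : dlprog G) (I C S : dlform G) :
  valid R (FImp (FAnd I (FNot C))
                (FBox (PStar (PSeq alpha (PTest (FNot C)))) S)) ->
  valid R (FImp C (FBox alpha C)) ->
  valid R (FImp C S) ->
  valid R (FImp I (FBox (PStar alpha) S)).
Proof.
move=> avoidC invC CS J eta nu Inu om [n [s [s0 sn run]]].
have [[i le_in Ci]|noC] :=
    pselect (exists2 i, (i <= n)%N & sat J C eta (s i)).
  by rewrite -sn; apply: CS; apply: sat_persists (invC J eta) run _ le_in Ci.
have notC i : (i <= n)%N -> ~ sat J C eta (s i).
  by move=> le_in Ci; apply: noC; exists i.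
apply: (avoidC J eta nu).
  (* Index [0] is in the range of [notC] even when [n] is [0]. *)
  by split=> //; rewrite -s0; apply: notC.
(* A test leaves the state unchanged, so [s i.+1] is the state both before and after [?~C]; the test
   passes there because [i < n] gives [i.+1 <= n]. *)
exists n, s; split=> // i lt_in; exists (s i.+1); split; first exact: run.
by split=> //; apply: notC.
Qed.
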